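(* Let $X_1\subset X_2\subset X$ be a triple of Banach spaces, let $u\in X$, let $u_1\in X_1$ and $u_2\in X_2$ be approximations to $u$, with $$e_2=\|u-u_2\|_X,\qquad e_1=\|u-u_1\|_X,\qquad E_1=\|u_2-u_1\|_X,$$ and let $\eta_1=\eta_1(u_1)$, $\eta_2=\eta_2(u_2)$ be the values of error indicators $\eta_1:X_1\to\mathbb{R}$, $\eta_2:X_2\to\mathbb{R}$. Assume: (Quasi-orthogonality) there exists $\Lambda\ge1$ such that $e_2^2\le\Lambda e_1^2-E_1^2$; (Upper bound) there exists $C_1>0$ such that $e_k^2\le C_1\eta_k^2$, $k=1,2$; (Indicator reduction) there exist $C_2>0$ and $\omega\in(0,1)$ such that $\eta_2^2\le C_2E_1^2+(1-\omega)\eta_1^2$. Let $\beta\in(0,1)$ be arbitrary, and assume that $$1\le\Lambda<1+\frac{\beta\omega}{C_1C_2}.$$ Then there exist $\gamma>0$ and $\alpha\in(0,1)$ such that $$e_2^2+\gamma\eta_2^2\le\alpha^2\left(e_1^2+\gamma\eta_1^2\right),$$ where $\gamma$ can be taken to be anything in the non-empty interval $$\frac{(\Lambda-1)C_1}{\beta\omega}<\gamma<\min\left\{\frac1{C_2},\frac{\Lambda C_1}{\beta\omega}\right\},$$ and $\alpha$ is subsequently given by $\alpha^2=\max\{\alpha_1^2,\alpha_2^2\}\in(0,1)$ with $$0<\alpha_1^2=\Lambda-\frac{\beta\omega\gamma}{C_1}<1,\qquad0<\alpha_2^2=1-[1-\beta]\omega<1 .$$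
   Context: $\|\cdot\|_X$ denotes a norm on $X$, either the native Banach norm or more generally a norm associated with a problem-specific bilinear form. *)

(* Defs.v *)
From mathcomp Require Import all_boot all_order all_algebra.
From mathcomp Require Import classical_sets reals topology normedtype.

Set Implicit Arguments.
Unset Strict Implicit.
Unset Printing Implicit Defensive.

Import Order.TTheory GRing.Theory Num.Theory.
Import numFieldNormedType.Exports.

Local Open Scope ring_scope.

(* The library's norm is part of the structure of a normedModType. This
   predicate allows a second norm, such as an energy norm, on the same space;
   nonnegativity follows from the three axioms. *)
Record is_norm (R : realType) (V : lmodType R) (N : V -> R) : Prop := IsNorm {
  is_norm_triangle : forall x y : V, N (x + y) <= N x + N y ;
  is_norm_scale : forall (a : R) (x : V), N (a *: x) = `|a| * N x ;
  is_norm_definite : forall x : V, N x = 0 -> x = 0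
}.

Lemma is_norm_native (R : realType) (V : normedModType R) :
  is_norm (fun x : V => `|x|).
Proof.
split=> [x y|a x|x]; [exact: ler_normD | exact: normrZ | exact: normr0_eq0].
Qed.

(* Main.v *)
Require Import Defs.
From mathcomp Require Import all_boot all_order all_algebra.
From mathcomp Require Import classical_sets reals topology normedtype.
From mathcomp Require Import ring lra.

(** The combined quantity error^2 + gamma * indicator^2 contracts because each
    of its two terms pays for the defect of the other.  Quasi-orthogonality
    gains [- E1^2], which absorbs the [gamma * C2 * E1^2] of the indicator
    reduction once [gamma * C2 <= 1].  What remains is the error term amplified
    by [Lambda >= 1] and the indicator term damped by [1 - omega].  The damping
    is split into the fractions [beta] and [1 - beta]: the latter stays with the
    indicator, while the former is turned by the upper bound into a decrease
    of [beta * omega * gamma / C1] of the error factor, which has to beat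
    [Lambda - 1] ([contraction_estimate]).

    The interval for [gamma] records exactly these demands.  Its lower end is
    the threshold for an error factor below 1, and its upper end collects those
    for the absorption of [E1^2] and for a positive error factor
    ([error_factor_lt1], [error_factor_gt0]).  The bound on [Lambda] leaves room
    between the lower end, which grows with [Lambda - 1], and the
    absorption constraint ([weight_interval_nonempty]). *)

Set Implicit Arguments.
Unset Strict Implicit.
Unset Printing Implicit Defensive.

Import Order.TTheory GRing.Theory Num.Theory.
Import numFieldNormedType.Exports.

Local Open Scope ring_scope.

(** Here and in the next three lemmas, [d] stands for [beta * omega], the part
    of the indicator reduction that is transferred to the error. *)
Lemma error_factor_lt1 (R : realFieldType) (Lambda C1 d g : R) :
    0 < C1 -> 0 < d ->
  (Lambda - d * g / C1 < 1) = ((Lambda - 1) * C1 / d < g).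
Proof.
move=> C1_gt0 d_gt0.
by rewrite ltrBlDr -ltrBlDl ltr_pdivlMr // ltr_pdivrMr // [g * d]mulrC.
Qed.

Lemma error_factor_gt0 (R : realFieldType) (Lambda C1 d g : R) :
    0 < C1 -> 0 < d ->
  (0 < Lambda - d * g / C1) = (g < Lambda * C1 / d).
Proof.
move=> C1_gt0 d_gt0.
by rewrite subr_gt0 ltr_pdivrMr // ltr_pdivlMr // [g * d]mulrC.
Qed.

Lemma weight_lower_ge0 (R : realFieldType) (Lambda C1 d : R) :
    1 <= Lambda -> 0 < C1 -> 0 < d ->
  0 <= (Lambda - 1) * C1 / d.
Proof.
move=> Lambda_ge1 C1_gt0 d_gt0.
by rewrite divr_ge0 ?mulr_ge0 ?subr_ge0 // ltW.
Qed.

Lemma weight_interval_nonempty (R : realFieldType) (Lambda C1 C2 d : R) :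
    0 < C1 -> 0 < C2 -> 0 < d -> Lambda < 1 + d / (C1 * C2) ->
  (Lambda - 1) * C1 / d < Num.min (1 / C2) (Lambda * C1 / d).
Proof.
move=> C1_gt0 C2_gt0 d_gt0.
rewrite -ltrBlDl ltr_pdivlMr ?mulr_gt0 // => Lambda_lt.
rewrite lt_min; apply/andP; split.
  by rewrite ltr_pdivrMr // mulrAC mul1r ltr_pdivlMr // -mulrA.
by rewrite ltr_pM2r ?invr_gt0 // ltr_pM2r // ltrBlDr ltrDl.
Qed.

Lemma indicator_factor_itv (R : realFieldType) (beta omega : R) :
    0 < beta < 1 -> 0 < omega < 1 ->
  0 < 1 - (1 - beta) * omega < 1.
Proof. by move=> /andP[? ?] /andP[? ?]; apply/andP; split; nra. Qed.

(** The three assumptions are linear in the squares of the errors and of the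
    indicators, and the estimate is a nonnegative combination of them: weight 1
    on the first, [beta * omega * g / C1] on the second and [g] on the third,
    the remaining multiple [g * C2 - 1] of [E] being nonpositive.
    Hence [e1], [e2], [E], [h1], [h2] stand for the squared quantities. *)
Lemma contraction_estimate (R : realFieldType)
    (Lambda C1 C2 g beta omega e1 e2 E h1 h2 : R) :
    0 < C1 -> 0 <= g -> g * C2 <= 1 -> 0 <= beta * omega -> 0 <= E ->
    e2 <= Lambda * e1 - E -> e1 <= C1 * h1 ->
    h2 <= C2 * E + (1 - omega) * h1 ->
  e2 + g * h2 <= (Lambda - beta * omega * g / C1) * e1
                 + (1 - (1 - beta) * omega) * (g * h1).
Proof.
move=> C1_gt0 g_ge0 gC2_le1 d_ge0 E_ge0 quasi_orth upper reduction.
have absorb : g * C2 * E <= E by rewrite ler_piMl.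
have weighted : g * h2 <= g * (C2 * E + (1 - omega) * h1) by rewrite ler_wpM2l.
have transfer : beta * omega * g * (e1 / C1) <= beta * omega * g * h1.
  apply: ler_wpM2l; first exact: mulr_ge0.
  by rewrite ler_pdivrMr // mulrC.
have -> : (Lambda - beta * omega * g / C1) * e1
          = Lambda * e1 - beta * omega * g * (e1 / C1) by ring.
lra.
Qed.

(* The inclusions X1 \subset X2 \subset X are the injective linear maps
   i12 and i2; N is the norm written ||.||_X. *)
Theorem theorem6p9 (R : realType) (X X1 X2 : completeNormedModType R)
    (i12 : {linear X1 -> X2}) (i2 : {linear X2 -> X})
    (i12_inj : injective i12) (i2_inj : injective i2)
    (N : X -> R) (N_norm : is_norm N)
    (u : X) (u1 : X1) (u2 : X2)
    (eta1 : X1 -> R) (eta2 : X2 -> R)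
    (Lambda C1 C2 omega beta : R) :
  let e2 := N (u - i2 u2) in
  let e1 := N (u - i2 (i12 u1)) in
  let E1 := N (i2 u2 - i2 (i12 u1)) in
  let h1 := eta1 u1 in
  let h2 := eta2 u2 in
  (* quasi-orthogonality *)
  1 <= Lambda -> e2 ^+ 2 <= Lambda * e1 ^+ 2 - E1 ^+ 2 ->
  (* upper bound *)
  0 < C1 -> e1 ^+ 2 <= C1 * h1 ^+ 2 -> e2 ^+ 2 <= C1 * h2 ^+ 2 ->
  (* indicator reduction *)
  0 < C2 -> 0 < omega < 1 ->
  h2 ^+ 2 <= C2 * E1 ^+ 2 + (1 - omega) * h1 ^+ 2 ->
  0 < beta < 1 ->
  Lambda < 1 + beta * omega / (C1 * C2) ->
  let lo := (Lambda - 1) * C1 / (beta * omega) in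
  let hi := Num.min (1 / C2) (Lambda * C1 / (beta * omega)) in
  let alpha1_sq (gamma : R) := Lambda - beta * omega * gamma / C1 in
  let alpha2_sq := 1 - (1 - beta) * omega in
  let contracts (gamma alpha : R) :=
    e2 ^+ 2 + gamma * h2 ^+ 2 <= alpha ^+ 2 * (e1 ^+ 2 + gamma * h1 ^+ 2) in
  [/\ exists gamma alpha : R,
        [/\ 0 < gamma, 0 < alpha < 1 & contracts gamma alpha],
      exists gamma : R, lo < gamma < hi
    & forall gamma : R, lo < gamma < hi ->
        [/\ 0 < gamma,
            0 < alpha1_sq gamma < 1,
            0 < alpha2_sq < 1
          & exists alpha : R,
              [/\ 0 < alpha < 1,
                  alpha ^+ 2 = Num.max (alpha1_sq gamma) alpha2_sq
                & contracts gamma alpha]]].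
Proof.
move=> e2 e1 E1 h1 h2 Lambda_ge1 quasi_orth C1_gt0 upper1 _ C2_gt0 omega01.
move=> reduction beta01 Lambda_lt lo hi alpha1_sq alpha2_sq contracts.
have d_gt0 : 0 < beta * omega.
  by case/andP: beta01 => ? _; case/andP: omega01 => ? _; rewrite mulr_gt0.
have lo_lt_hi : lo < hi by exact: weight_interval_nonempty.
have all_weights gamma : lo < gamma < hi ->
    [/\ 0 < gamma, 0 < alpha1_sq gamma < 1, 0 < alpha2_sq < 1
      & exists alpha : R, [/\ 0 < alpha < 1,
          alpha ^+ 2 = Num.max (alpha1_sq gamma) alpha2_sq
        & contracts gamma alpha]].
  rewrite lt_min => /and3P[lo_lt gamma_lt_C2 gamma_lt_Lambda].
  have gamma_gt0 : 0 < gamma.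
    by apply: le_lt_trans lo_lt; exact: weight_lower_ge0.
  have a1_itv : 0 < alpha1_sq gamma < 1.
    by rewrite /alpha1_sq error_factor_gt0 // error_factor_lt1 // gamma_lt_Lambda.
  have a2_itv : 0 < alpha2_sq < 1 by exact: indicator_factor_itv.
  split=> //; set m := Num.max _ _.
  have [m_gt0 m_lt1] : 0 < m /\ m < 1.
    case/andP: a1_itv => a1_gt0 a1_lt1; case/andP: a2_itv => _ a2_lt1.
    by rewrite lt_max a1_gt0 gt_max a1_lt1.
  have sqrt_m : Num.sqrt m ^+ 2 = m by rewrite sqr_sqrtr // ltW.
  exists (Num.sqrt m); split=> //.
    by rewrite sqrtr_gt0 m_gt0 -sqrtr1 ltr_sqrt ?m_lt1.
  rewrite /contracts sqrt_m mulrDr.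
  apply: (le_trans (y := alpha1_sq gamma * e1 ^+ 2
                         + alpha2_sq * (gamma * h1 ^+ 2))).
    apply: (contraction_estimate (C2 := C2) (E := E1 ^+ 2)) => //.
    - exact: ltW.
    - by rewrite -ler_pdivlMr // ltW.
    - exact: ltW.
    - exact: sqr_ge0.
  rewrite lerD // ler_wpM2r ?sqr_ge0 ?le_max ?lexx ?orbT //.
  by rewrite mulr_ge0 ?sqr_ge0 // ltW.
have [gamma gamma_itv] : exists gamma, lo < gamma < hi.
  by exists ((lo + hi) / 2); rewrite !midf_lt.
split=> //; last by exists gamma.
have [gamma_gt0 _ _ [alpha [alpha01 _ contr]]] := all_weights _ gamma_itv.
by exists gamma, alpha.
Qed.
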